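(* Every outer $2$-planar graph has treewidth at most $4$, and this bound is tight: there is an outer $2$-planar graph with treewidth exactly $4$.
   Context: A convex drawing of a finite simple graph $G$ places the vertices of $G$ at distinct points of a circle and draws every edge as a straight-line segment. A convex drawing is outer $k$-planar if every edge crosses at most $k$ other edges. A graph is outer $k$-planar if it admits an outer $k$-planar drawing. *)

(* Defs.v *)
From HB Require Import structures.
From mathcomp Require Import all_boot all_order all_algebra.
From mathcomp Require Import boolp reals.

Set Implicit Arguments.
Unset Strict Implicit.
Unset Printing Implicit Defensive.

Import Order.TTheory GRing.Theory Num.Theory.

Record sgraph := SGraph {
  vertex :> finType;
  adj : rel vertex;
  adj_sym : symmetric adj;
  adj_irr : irreflexive adj
}.

Definition edges (G : sgraph) : {set {set G}} :=
  [set [set p.1; p.2] | p : G * G & adj p.1 p.2].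

Section Drawing.
Local Open Scope ring_scope.

Definition on_circle (R : realType) (c : 'rV[R]_2) (r : R) (p : 'rV[R]_2) :
    Prop :=
  (p 0 0 - c 0 0) ^+ 2 + (p 0 1 - c 0 1) ^+ 2 = r ^+ 2.

Record convex_drawing (R : realType) (G : sgraph) := ConvexDrawing {
  position :> G -> 'rV[R]_2;
  center : 'rV[R]_2;
  radius : R;
  radius_gt0 : 0 < radius;
  position_inj : injective position;
  position_on_circle : forall v, on_circle center radius (position v)
}.

Definition open_segment (R : realType) (a b p : 'rV[R]_2) : Prop :=
  exists2 t : R, 0 < t < 1 & p = (1 - t) *: a + t *: b.

Definition edge_interior (R : realType) (G : sgraph) (D : convex_drawing R G)
    (e : {set G}) (p : 'rV[R]_2) : Prop :=
  exists x y : G, e = [set x; y] /\ open_segment (D x) (D y) p.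

(* Only relative interiors count: meeting in a common endpoint is not a
   crossing.  As vertices lie on a circle, no vertex lies in the interior of
   an edge. *)
Definition edges_cross (R : realType) (G : sgraph) (D : convex_drawing R G)
    (e f : {set G}) : Prop :=
  exists p, edge_interior D e p /\ edge_interior D f p.

End Drawing.

Definition outer_kplanar_drawing (R : realType) (k : nat) (G : sgraph)
    (D : convex_drawing R G) : Prop :=
  forall e, e \in edges G ->
    #|[set f in edges G :\ e | `[< edges_cross D e f >]]| <= k.

Definition outer_kplanar (R : realType) (k : nat) (G : sgraph) : Prop :=
  exists D : convex_drawing R G, outer_kplanar_drawing k D.

Definition connected (G : sgraph) : Prop :=
  0 < #|G| /\ forall x y : G, connect (@adj G) x y.

(* For a symmetric relation, [:: x; y] with x, y adjacent is a degenerate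
   ucycle, hence the size condition. *)
Definition acyclic (G : sgraph) : Prop :=
  forall c : seq G, 2 < size c -> ~ ucycle (@adj G) c.

Definition is_tree (G : sgraph) : Prop := connected G /\ acyclic G.

Record tree_decomposition (G : sgraph) := TreeDecomposition {
  node : sgraph;
  node_tree : is_tree node;
  bag : node -> {set G};
  bag_vertex : forall v : G, exists t, v \in bag t;
  bag_edge : forall u v : G, adj u v -> exists t, (u \in bag t) && (v \in bag t);
  bag_connected : forall (v : G) (s t : node), v \in bag s -> v \in bag t ->
    connect [rel a b | [&& adj a b, v \in bag a & v \in bag b]] s t
}.

(* The truncated predecessor gives width 0 when all bags are empty, which is
   possible only for the graph without vertices. *)
Definition width (G : sgraph) (D : tree_decomposition G) : nat :=
  (\max_(t : node D) #|bag t|).-1.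

Lemma point_adj_sym : symmetric (fun _ _ : unit => false).
Proof. by []. Qed.

Lemma point_adj_irr : irreflexive (fun _ : unit => fun _ : unit => false).
Proof. by []. Qed.

Definition point_graph : sgraph := SGraph point_adj_sym point_adj_irr.

Lemma point_is_tree : is_tree point_graph.
Proof.
split; first by split; [rewrite card_unit | case; case; exact: connect0].
by case=> [|x [|y [|z c]]] // _ /andP[].
Qed.

Lemma exists_width (G : sgraph) :
  exists k, `[< exists D : tree_decomposition G, width D = k >].
Proof.
unshelve evar (D : tree_decomposition G).
  apply: (@TreeDecomposition G point_graph point_is_tree (fun=> setT)).
  - by move=> v; exists tt; rewrite inE.
  - by move=> u v _; exists tt; rewrite !inE.
  - by move=> v [] [] _ _; exact: connect0.
by exists (width D); apply/asboolP; exists D.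
Qed.

Definition treewidth (G : sgraph) : nat := ex_minn (exists_width G).

(* Main.v *)
(* Upper bound. Number the vertices along the circle and, for a chord [ab]
   crossed by at most two edges, decompose the graph induced on the arc from a
   to b with a root bag consisting of a, b and the ends, on this arc, of the
   edges crossing [ab]. If no edge crosses [ab], cut at the last neighbour c of
   a on the arc; otherwise cut at the end c of a crossing edge cq which, when
   [ab] is crossed twice, also meets an edge not strictly inside the arc, hence
   meets at most one edge inside. Then at most two edges either join the two
   open parts or cross [ab] at an end other than c, so a bag with a, b, c and
   one end of each of them has size at most 5; before gluing, the ends of the
   edges crossing [ac] and [cb] are swapped one by one, in bags of size at most
   5.

   Tightness. The complete graph on five vertices in convex position has two
   crossings on each diagonal, and some bag of any tree decomposition contains
   every vertex: otherwise orient an edge out of each node t towards the subtree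
   of a vertex missing from the bag of t, and follow these edges until one of
   them is traversed in both directions. *)

Require Import Defs.
From mathcomp Require Import all_boot all_order all_algebra.
From mathcomp Require Import boolp reals.
From mathcomp Require Import zify ring lra.

Set Implicit Arguments.
Unset Strict Implicit.
Unset Printing Implicit Defensive.

(** * Rooted tree decompositions *)

(* The vertices of the bags are exactly those of A, the root bag is R and every
   pair in E lies in a bag. As depth decreases towards the root, the last field
   says that the nodes containing a given vertex form a subtree. *)
Record rooted_dec (V : finType) (k : nat) (R A : {set V}) (E : V -> V -> Prop) :=
  RootedDec {
  rnode : finType;
  rroot : rnode;
  parent : rnode -> rnode;
  depth : rnode -> nat;
  rbag : rnode -> {set V};
  depth_parent : forall x, x != rroot -> depth (parent x) < depth x;
  rbag_root : rbag rroot = R;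
  rbag_card : forall x, #|rbag x| <= k;
  rbag_sub : forall x, rbag x \subset A;
  rbag_vertex : forall v, v \in A -> exists x, v \in rbag x;
  rbag_edge : forall u v, E u v -> exists x, (u \in rbag x) && (v \in rbag x);
  rbag_highest : forall v x y,
    v \in rbag x -> (x == rroot) || (v \notin rbag (parent x)) ->
    v \in rbag y -> (y == rroot) || (v \notin rbag (parent y)) -> x = y
}.

Lemma leaf_dec (V : finType) k (B : {set V}) :
  #|B| <= k -> rooted_dec k B B (fun u v => u \in B /\ v \in B).
Proof.
move=> leBk.
apply: (@RootedDec _ _ _ _ _ unit tt id (fun=> 0) (fun=> B)) => //.
- by move=> u v [-> ->]; exists tt.
- by move=> v [] [].
Qed.

Section Join.
Variables (V : finType) (k : nat) (R1 R2 A1 A2 B : {set V}).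
Variables E1 E2 : V -> V -> Prop.
Variables (D1 : rooted_dec k R1 A1 E1) (D2 : rooted_dec k R2 A2 E2).
Hypothesis leBk : #|B| <= k.
Hypotheses (sub12 : A1 :&: A2 \subset B) (sub1 : A1 :&: B \subset R1)
  (sub2 : A2 :&: B \subset R2).

Let T : finType := option (rnode D1 + rnode D2)%type.
Let par (x : T) : T := match x with
  | None => None
  | Some (inl y) => if y == rroot D1 then None else Some (inl (parent y))
  | Some (inr y) => if y == rroot D2 then None else Some (inr (parent y))
  end.
Let dep (x : T) := match x with
  | None => 0 | Some (inl y) => (depth y).+1 | Some (inr y) => (depth y).+1 end.
Let bg (x : T) := match x with
  | None => B | Some (inl y) => rbag y | Some (inr y) => rbag y end.

(** A new root with bag [B] gets both old roots as children. By [sub1] and [sub2], a vertex of [B]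
    occurring on one side also lies in the root bag of that side, so its highest node is the new
    root. By [sub12], any other vertex occurs on one side only and keeps its highest node. *)
Lemma join_dec : rooted_dec k B (B :|: A1 :|: A2)
  (fun u v => (u \in B /\ v \in B) \/ E1 u v \/ E2 u v).
Proof.
have b1 v (x : rnode D1) : v \in rbag x -> v \in A1 by apply/subsetP/rbag_sub.
have b2 v (x : rnode D2) : v \in rbag x -> v \in A2 by apply/subsetP/rbag_sub.
have h1 v (x : rnode D1) : v \in rbag x -> v \in B ->
    ~~ (v \notin bg (par (Some (inl x)))).
  move=> vx vB; rewrite negbK /=; case: eqP => //= xr.
  apply: contra_notT xr => nv.
  apply: (rbag_highest vx); rewrite ?nv ?orbT ?eqxx //.
  by rewrite rbag_root; apply: (subsetP sub1); rewrite inE (b1 _ _ vx).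
have h2 v (x : rnode D2) : v \in rbag x -> v \in B ->
    ~~ (v \notin bg (par (Some (inr x)))).
  move=> vx vB; rewrite negbK /=; case: eqP => //= xr.
  apply: contra_notT xr => nv.
  apply: (rbag_highest vx); rewrite ?nv ?orbT ?eqxx //.
  by rewrite rbag_root; apply: (subsetP sub2); rewrite inE (b2 _ _ vx).
apply: (@RootedDec _ _ _ _ _ T None par dep bg) => //.
- by case=> [[y|y]|] //= _; case: eqP => //= /eqP; rewrite ltnS; apply: depth_parent.
- by case=> [[y|y]|] //=; apply: rbag_card.
- case=> [[y|y]|] //=; last by rewrite -setUA subsetUl.
  + by apply: subset_trans (rbag_sub y) _; rewrite setUAC subsetUr.
  + by apply: subset_trans (rbag_sub y) _; rewrite subsetUr.
- move=> v /setUP[/setUP[vB|/(rbag_vertex D1)[x]]|/(rbag_vertex D2)[x]].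
  + by exists None.
  + by exists (Some (inl x)).
  + by exists (Some (inr x)).
- move=> u v [[uB vB]|[/(rbag_edge D1)[x]|/(rbag_edge D2)[x]]].
  + by exists None; rewrite /= uB.
  + by exists (Some (inl x)).
  + by exists (Some (inr x)).
- move=> v x y.
  have [vB|vB] := boolP (v \in B).
    have aux z : v \in bg z -> (z == None) || (v \notin bg (par z)) -> z = None.
      case: z => [[z|z]|] // vz /orP[] // nv.
        by have := h1 _ _ vz vB; rewrite nv.
      by have := h2 _ _ vz vB; rewrite nv.
    by move=> vx tx vy ty; rewrite (aux x) // (aux y).
  case: x => [[x|x]|]; case: y => [[y|y]|] //=; rewrite ?(negPf vB) //.
  + move=> vx tx vy ty; congr (Some (inl _)); apply: (rbag_highest vx) => //.
      by move: tx; case: (x == _).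
    by move: ty; case: (y == _).
  + by move=> vx _ vy; move/subsetP/(_ v): sub12;
    rewrite inE (b1 _ _ vx) (b2 _ _ vy) (negPf vB) => /(_ isT).
  + by move=> vx _ vy; move/subsetP/(_ v): sub12;
    rewrite inE (b1 _ _ vy) (b2 _ _ vx) (negPf vB) => /(_ isT).
  + move=> vx tx vy ty; congr (Some (inr _)); apply: (rbag_highest vx) => //.
      by move: tx; case: (x == _).
    by move: ty; case: (y == _).
Qed.
End Join.

Lemma weaken_dec (V : finType) k (R A A' : {set V}) (E E' : V -> V -> Prop) :
  rooted_dec k R A E -> A = A' -> (forall u v, E' u v -> E u v) ->
  rooted_dec k R A' E'.
Proof.
move=> [T r par dep bg dp rr cd sb vx ed hi] <- EE'.
by apply: (@RootedDec _ _ _ _ _ T r par dep bg) => // u v /EE' /ed.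
Qed.

(** Joining with a one-node decomposition of bag [B] amounts to putting a new root [B] on top of the
    given decomposition. *)
Lemma grow_dec (V : finType) k (R A B : {set V}) (E : V -> V -> Prop) :
  rooted_dec k R A E -> #|B| <= k -> A :&: B \subset R ->
  rooted_dec k B (B :|: A) (fun u v => (u \in B /\ v \in B) \/ E u v).
Proof.
move=> D leBk sAB.
apply: weaken_dec (join_dec D (leaf_dec leBk) leBk (subsetIr _ _) sAB
  (subsetIl _ _)) _ _.
  by rewrite setUAC setUid.
by move=> u v [uv|uv]; [left | right; left].
Qed.

(** * Rooted decompositions as tree decompositions *)

Section RootedTree.
Variables (V : finType) (k : nat) (R A : {set V}) (E : V -> V -> Prop).
Variable D : rooted_dec k R A E.
Notation T := (rnode D).

Definition child_of (x y : T) := (x != rroot D) && (parent x == y).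
Definition tree_rel (x y : T) := child_of x y || child_of y x.

Lemma tree_rel_sym : symmetric tree_rel.
Proof. by move=> x y; rewrite /tree_rel orbC. Qed.

Lemma child_depth x y : child_of x y -> depth y < depth x.
Proof. by case/andP=> xr /eqP<-; apply: depth_parent. Qed.

Lemma tree_rel_irr : irreflexive tree_rel.
Proof.
by move=> x; apply/negbTE/negP => /orP[] /child_depth; rewrite ltnn.
Qed.

Definition rooted_tree := SGraph tree_rel_sym tree_rel_irr.

Lemma rooted_tree_is_tree : is_tree rooted_tree.
Proof.
split.
  split; first by apply/card_gt0P; exists (rroot D).
  have sym := sym_connect_sym tree_rel_sym.
  suff to_root x : connect tree_rel x (rroot D).
    by move=> x y; apply: connect_trans (to_root x) _; rewrite sym; apply: to_root.
  have [n] := ubnP (depth x); elim: n x => // n IH x; rewrite ltnS => xn.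
  have [->|xr] := eqVneq x (rroot D); first exact: connect0.
  apply: connect_trans (IH (parent x) _); last exact: leq_trans (depth_parent xr) xn.
  by apply: connect1; rewrite /tree_rel /child_of xr eqxx.
move=> c c2 cyc.
have [x0 x0c] : exists x, x \in c by case: c c2 {cyc} => // x c _; exists x; rewrite mem_head.
(* On a cycle, both neighbours of a deepest node would be its parent, although the nodes of the
   cycle are distinct. *)
have [/= x xc xmax] := @arg_maxnP _ x0 (mem c) (@depth _ _ _ _ _ D) x0c.
have [i p def_p] := rot_to xc.
move: cyc c2; rewrite -(rot_ucycle i) -(size_rot i) def_p.
have pmax y : y \in p -> depth y <= depth x.
  by move=> yp; apply: xmax; rewrite /= -(mem_rot i) def_p inE yp orbT.
have up y : y \in p -> tree_rel x y -> y = parent x.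
  move=> /pmax yx /orP[/andP[_ /eqP//]|/child_depth]; lia.
case: p pmax up {def_p} => [|y p] // pmax up /andP[]; case/lastP: p pmax up => // p z _ up.
rewrite /= rcons_path last_rcons mem_rcons.
move=> /andP[xy /andP[_ zx]] /andP[_ /andP[yz _]] _.
have ez : z = parent x by apply: up; rewrite ?inE ?mem_rcons ?mem_head ?orbT // tree_rel_sym.
by move: yz; rewrite inE (up y) ?mem_head // ez eqxx.
Qed.

(** Climbing from a node while the parent's bag still contains [v] stays in the subgraph and stops
    at a highest node, which [rbag_highest] makes the same for [s] and [t]. *)
Lemma rooted_bag_connected v (s t : rooted_tree) :
  v \in rbag s -> v \in rbag t ->
  connect [rel a b | [&& tree_rel a b, v \in rbag a & v \in rbag b]] s t.
Proof.
move=> vs vt; set e := rel_of_simpl _.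
have sym : connect_sym e.
  by apply: sym_connect_sym => x y; rewrite /e /= tree_rel_sym [X in _ && X]andbC.
suff to_top (x : T) : v \in rbag x -> exists2 y : T, connect e x y &
    (v \in rbag y) /\ (y == rroot D) || (v \notin rbag (parent y)).
  have [s' cs [vs' ts]] := to_top _ vs; have [t' ct [vt' tt]] := to_top _ vt.
  apply: (connect_trans cs); rewrite sym.
  by rewrite (rbag_highest vs' ts vt' tt).
have [n] := ubnP (depth x); elim: n x => // n IH x; rewrite ltnS => xn vx.
have [top|] := boolP ((x == rroot D) || (v \notin rbag (parent x))).
  by exists x => //; apply: connect0.
rewrite negb_or negbK => /andP[xr vp].
have [y cy ty] := IH _ (leq_trans (depth_parent xr) xn) vp.
exists y => //; apply: connect_trans cy; apply: connect1.
by rewrite /e /= vx vp /tree_rel /child_of xr eqxx.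
Qed.

End RootedTree.

Lemma treewidth_le (G : sgraph) (D : tree_decomposition G) : treewidth G <= width D.
Proof.
rewrite /treewidth; case: ex_minnP => m _; apply.
by apply/asboolP; exists D.
Qed.

Lemma rooted_treewidth (G : sgraph) k (R : {set G}) :
  rooted_dec k.+1 R setT (fun u v => adj u v) -> treewidth G <= k.
Proof.
move=> D.
unshelve evar (D' : tree_decomposition G).
  apply: (@TreeDecomposition G (rooted_tree D) (rooted_tree_is_tree D) (@rbag _ _ _ _ _ D)).
  - by move=> v; apply: (rbag_vertex D); rewrite inE.
  - by move=> u v uv; apply: (rbag_edge D).
  - exact: rooted_bag_connected.
apply: leq_trans (treewidth_le D') _; rewrite /width -subn1 leq_subLR add1n.
by apply/bigmax_leqP => t _; apply: rbag_card.
Qed.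

(** * Complete graphs *)

Definition minus_edge (T : sgraph) (t t' : T) : rel T :=
  [rel x y | adj x y && ~~ [|| (x == t) && (y == t') | (x == t') && (y == t)]].

Definition branch (T : sgraph) (t t' : T) : {set T} :=
  [set s | connect (minus_edge t t') t' s].

Lemma minus_edgeC (T : sgraph) (t t' x y : T) :
  minus_edge t t' x y = minus_edge t' t x y.
Proof. by rewrite /minus_edge /= orbC. Qed.

Lemma minus_edge_sym (T : sgraph) (t t' : T) : symmetric (minus_edge t t').
Proof.
by move=> x y; rewrite /minus_edge /= adj_sym orbC andbC [(y == t) && _]andbC
  [(y == t') && _]andbC andbC.
Qed.

(** The removed edge has [z] as an end, so a path missing [z] cannot use it. *)
Lemma minus_edge_path (T : sgraph) (t t' z x : T) (e : rel T) (p : seq T) :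
  (z == t) || (z == t') -> subrel e (@adj T) -> z \notin x :: p ->
  path e x p -> path (minus_edge t t') x p.
Proof.
move=> ztt' sub zp; apply: (@sub_in_path _ (predC1 z)).
  move=> a b; rewrite !inE => az bz /sub ab; rewrite /minus_edge /= ab /=.
  by case/orP: ztt' az bz => /eqP-> /negPf-> /negPf->; rewrite ?andbF.
by apply/allP => a ap; rewrite !inE; apply: contraNneq zp => <-.
Qed.

(** A simple path from [t'] to [t] without the edge [tt'] has at least three nodes, and that edge
    closes it into a cycle. *)
Lemma acyclic_bridge (T : sgraph) (t t' : T) :
  acyclic T -> adj t t' -> t \notin branch t t'.
Proof.
move=> acyc tt'; apply/negP; rewrite inE => /connectP[p0 p0path lastp].
case/shortenP: p0path lastp => p pp up _ lastp.
have sub : subrel (minus_edge t t') (@adj T) by move=> a b /andP[].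
case: p pp up lastp => [|y [|z p]] pp up lastp.
- by rewrite lastp adj_irr in tt'.
- by move: pp lastp => /= + lastp; rewrite -lastp /minus_edge /= !eqxx /= orbT andbF.
- apply: (acyc [:: t', y, z & p]) => //; apply/andP; split=> //.
  by rewrite /cycle rcons_path (sub_path sub pp) -lastp.
Qed.

Lemma complete_bag (G : sgraph) (D : tree_decomposition G) :
  (forall u v : G, u != v -> adj u v) -> exists t : node D, bag t = setT.
Proof.
move=> complete; have [[/card_gt0P[t0 _] conn] acyc] := node_tree D.
apply: contrapT => /forallNP nobag.
have missing (t : node D) : exists v, v \notin bag t.
  by have /eqP := nobag t; rewrite -subTset => /subsetPn[v _]; exists v.
(* The edge [tt'] is oriented away from [t] when all bags of some vertex lie beyond it. *)
pose escape (t t' : node D) := adj t t' /\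
  exists v, forall s, v \in bag s -> s \in branch t t'.
have escapes (t : node D) : exists t', escape t t'.
  have [v vt] := missing t; have [s vs] := bag_vertex D v.
  have /connectP[p0 p0path lastp] := conn t s.
  case/shortenP: p0path lastp => [[|t' p]] /= pp up _ lastp.
    by rewrite -lastp vs in vt.
  case/andP: pp up => tt' pp /andP[tp _].
  exists t'; split=> //; exists v => s' vs'; rewrite inE.
  apply: (@connect_trans _ _ s).
    apply/connectP; exists p => //.
    by apply: (minus_edge_path _ _ tp) pp => //; rewrite eqxx.
  (* Nodes whose bags contain [v] differ from [t], so connections among them avoid the edge
     [tt']. *)
  move: (bag_connected vs vs'); apply: connect_sub => a b /= /and3P[ab va vb].
  apply: connect1; rewrite /minus_edge /= ab /=.
  have at_ : a != t by apply: contraNneq vt => <-.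
  have bt : b != t by apply: contraNneq vt => <-.
  by rewrite (negPf at_) (negPf bt) andbF.
have [t1 esc1] := escapes t0.
(* The branch ahead shrinks strictly as long as the next escape does not turn back, so some escape
   must turn back. *)
have [n] := ubnP #|branch t0 t1|; elim: n t0 t1 esc1 => // n IH t t' esc.
rewrite ltnS => le_n.
have [t'' esc'] := escapes t'; have [tt' [v vb]] := esc; have [tt'' [w wb]] := esc'.
(* If the next escape turns back, the edge [tt'] separates the bags of [v] from those of [w]; but
   some bag contains both, since they are equal or adjacent. *)
have [et|nt] := eqVneq t'' t.
  have [s vs ws] : exists2 s : node D, v \in bag s & w \in bag s.
    have [<-|/complete/(bag_edge D)[s /andP[vs ws]]] := eqVneq v w.
      by have [s vs] := bag_vertex D v; exists s.
    by exists s.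
  have /negP[] := acyclic_bridge acyc tt'.
  move: (vb _ vs) (wb _ ws); rewrite et !inE => t's ts.
  apply: connect_trans t's _.
  rewrite (sym_connect_sym (@minus_edge_sym _ t t')).
  by rewrite (eq_connect (minus_edgeC t t')).
apply: (IH t' t'' esc'); apply: leq_trans le_n; apply: proper_card.
apply/properP; split; last first.
  by exists t'; [rewrite inE connect0 | apply: acyclic_bridge].
apply/subsetP => s; rewrite !inE => /connectP[p pp ->].
have t'p : t' \notin t'' :: p.
  apply: contra (acyclic_bridge acyc tt'') => t'p.
  by rewrite inE; apply: (path_connect pp).
apply: (@connect_trans _ _ t'').
  apply: connect1; rewrite /minus_edge /= tt'' (negPf nt) andbF orbF.
  by apply: contraTN tt' => /andP[/eqP<- _]; rewrite adj_irr.
apply/connectP; exists p => //.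
by apply: (minus_edge_path _ _ t'p) pp => [|a b /andP[]//]; rewrite eqxx orbT.
Qed.

Lemma complete_treewidth (G : sgraph) :
  (forall u v : G, u != v -> adj u v) -> #|G|.-1 <= treewidth G.
Proof.
move=> complete; rewrite /treewidth; case: ex_minnP => m /asboolP[D <-] _.
have [t bt] := complete_bag D complete.
rewrite /width -!subn1 leq_sub2r // -cardsT -bt.
by apply: (bigmax_sup t).
Qed.

(** * Decomposing along chords *)

Section RankedGraph.
Variables (G : sgraph) (rk : G -> nat).
Hypothesis rk_inj : injective rk.

(** Symmetric in [a] and [b], because [crossing] is also applied to edges whose ends come in either
    order. *)
Definition between (a b x : G) :=
  (rk a < rk x < rk b) || (rk b < rk x < rk a).

Definition within (a b x : G) :=
  (rk a <= rk x <= rk b) || (rk b <= rk x <= rk a).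

Definition piece (a b : G) : {set G} := [set x | within a b x].

(* Edges crossing the chord [ab], oriented outwards from the side between. *)
Definition crossing (a b : G) : {set G * G} :=
  [set p | [&& adj p.1 p.2, between a b p.1 & ~~ within a b p.2]].

(* The ends of [ab] and one end of each edge crossing it: the outer end for the
   edges in Y, the inner end for the others. *)
Definition mixed_bag (a b : G) (Y : {set G * G}) : {set G} :=
  [set a; b] :|: fst @: (crossing a b :\: Y) :|: snd @: Y.

(** The edges to be covered: those of the piece, and the crossing edges already exchanged for their
    outer end. The other crossing edges are left to later bags. *)
Definition mixed_edge (a b : G) (Y : {set G * G}) (u v : G) : Prop :=
  adj u v /\ [\/ within a b u /\ within a b v, (u, v) \in Y | (v, u) \in Y].

Definition decomposable (a b : G) (Y : {set G * G}) : Prop :=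
  inhabited (rooted_dec 5 (mixed_bag a b Y) (piece a b :|: snd @: Y)
    (mixed_edge a b Y)).

Let rkE (x y : G) : (x == y) = (rk x == rk y).
Proof. by rewrite (inj_eq rk_inj). Qed.

Lemma crossingP a b p : reflect
  [/\ adj p.1 p.2, between a b p.1 & ~~ within a b p.2] (p \in crossing a b).
Proof. by rewrite inE; apply: and3P. Qed.

Lemma card_mixed_bag a b (Y : {set G * G}) :
  Y \subset crossing a b -> #|mixed_bag a b Y| <= #|crossing a b| + 2.
Proof.
move=> sY; rewrite /mixed_bag -setUA.
apply: leq_trans (leq_card_setU _ _) _; rewrite addnC leq_add //; last first.
  by rewrite cards2; case: (_ == _).
apply: leq_trans (leq_card_setU _ _) _.
rewrite -(cardsID Y (crossing a b)) addnC (setIidPr sY).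
by rewrite leq_add // leq_imset_card.
Qed.

Lemma mixed_bag_sub a b (Y : {set G * G}) : rk a < rk b ->
  mixed_bag a b Y \subset piece a b :|: snd @: Y.
Proof.
move=> ab; apply/subsetP => x; rewrite !inE => /orP[|->]; last by rewrite orbT.
case/orP=> [|/imsetP[p /setDP[/crossingP[_ pb _] _] ->]].
  by rewrite !rkE /within; lia.
by apply/orP; left; move: pb; rewrite /between /within; lia.
Qed.

(** The edges of [Y] are exchanged one at a time: a new root adds the outer end of [e] to the
    current root bag, which covers [e], and a second new root then drops the inner end unless it is
    still needed. *)
Lemma swap_decomposable a b (Y : {set G * G}) : rk a < rk b -> #|crossing a b| <= 2 ->
  Y \subset crossing a b -> decomposable a b set0 -> decomposable a b Y.
Proof.
move=> ab cab + dec0; have [n] := ubnP #|Y|; elim: n Y => // n IH Y le_n sY.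
have [->//|[e eY]] := set_0Vmem Y.
have sYe : Y :\ e \subset crossing a b by apply: subset_trans sY; apply: subD1set.
have eX : e \in crossing a b by apply: (subsetP sY).
have [D] : decomposable a b (Y :\ e).
  by apply: IH => //; move: le_n; rewrite (cardsD1 e Y) eY.
set B := e.2 |: mixed_bag a b (Y :\ e).
(* Two ends of the chord, one end for each of at most two crossing edges, and the added vertex. *)
have cB : #|B| <= 5.
  apply: leq_trans (leq_card_setU _ _) _; rewrite cards1 (@leq_add 1 _ 1 4) //.
  by apply: leq_trans (card_mixed_bag sYe) _; rewrite addn2.
have sndY : snd @: Y = e.2 |: snd @: (Y :\ e).
  by rewrite -imsetU1 setD1K.
have sB : (piece a b :|: snd @: (Y :\ e)) :&: B \subset mixed_bag a b (Y :\ e).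
  apply/subsetP => x /setIP[xA /setU1P[xe|//]].
  case/setUP: xA; last by move=> xY; rewrite /mixed_bag in_setU xY orbT.
  by rewrite xe inE; case/crossingP: eX => _ _ /negPf->.
have sYB : mixed_bag a b Y \subset B.
  apply/subsetP => x; rewrite /B /mixed_bag sndY => /setUP[/setUP[|]|].
  - by rewrite !inE => /orP[] ->; rewrite ?orbT.
  - move=> xY; suff : x \in [set p.1 | p in crossing a b :\: (Y :\ e)].
      by rewrite !inE => ->; rewrite ?orbT.
    by apply: (subsetP _ _ xY); apply/imsetS/setDS/subD1set.
  - by rewrite !in_setU => /orP[]->; rewrite ?orbT.
have cY : #|mixed_bag a b Y| <= 5.
  by apply: leq_trans (card_mixed_bag sY) _; rewrite addn2 ltnW.
have D1 := grow_dec D cB sB.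
have D2 := grow_dec D1 cY (subset_trans (subsetIr _ _) sYB).
split; apply: weaken_dec D2 _ _.
  rewrite setUA (setUidPr sYB) sndY /B -setUA (setUidPr (mixed_bag_sub _ ab)).
  by rewrite setUCA.
move=> u v [uv cov]; right.
have me : e.1 \in B.
  rewrite /B /mixed_bag; apply/setU1P; right; rewrite !in_setU.
  apply/orP; left; apply/orP; right; apply/imsetP; exists e => //.
  by rewrite !inE eqxx; case/crossingP: eX => -> -> ->.
have me2 : e.2 \in B by rewrite /B setU11.
case: cov => [w|uvY|vuY]; first by right; split=> //; constructor 1.
  have [euv|ne] := eqVneq (u, v) e; first by left; move: me me2; rewrite -euv.
  by right; split=> //; constructor 2; rewrite in_setD1 ne.
have [euv|ne] := eqVneq (v, u) e; first by left; move: me me2; rewrite -euv.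
by right; split=> //; constructor 3; rewrite in_setD1 ne.
Qed.

Lemma mixed_edgeC a b Y u v : mixed_edge a b Y u v -> mixed_edge a b Y v u.
Proof.
case=> uv cov; split; first by rewrite adj_sym.
by case: cov => [[]|?|?]; [constructor 1 | constructor 3 | constructor 2].
Qed.

(** Both halves are glued under the bag [M] made of [a], [b], [c], the inner ends other than [c] of
    the edges crossing [ab], and the upper ends of the edges joining the two open parts. The budget
    of two is what keeps [M] at size 5. *)
Lemma split_decomposable a b c : rk a < rk c < rk b ->
  #|crossing a c| <= 2 -> #|crossing c b| <= 2 ->
  #|[set p in crossing a b | p.1 != c]|
    + #|[set p in crossing a c | between c b p.2]| <= 2 ->
  decomposable a c set0 -> decomposable c b set0 -> decomposable a b set0.
Proof.
set P := [set p in crossing a b | p.1 != c].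
set F := [set p in crossing a c | _].
move=> /andP[ac cb] cac ccb budget dac dcb; have ab := ltn_trans ac cb.
(* An edge from the open part below [c] to the upper half, [b] included, is covered in the lower
   half; an edge from [a] to the open part above [c] is covered in the upper half. *)
set Y1 := [set p in crossing a c | within c b p.2].
set Y2 := [set p in crossing c b | p.2 == a].
have [D1] : decomposable a c Y1.
  by apply: swap_decomposable => //; apply/subsetP => p /setIdP[].
have [D2] : decomposable c b Y2.
  by apply: swap_decomposable => //; apply/subsetP => p /setIdP[].
pose M := [set a; b; c] :|: fst @: P :|: snd @: F.
have cM : #|M| <= 5.
  rewrite /M -setUA; apply: leq_trans (leq_card_setU _ _) _.
  rewrite (@leq_add _ _ 3 2) //.
    apply: leq_trans (leq_card_setU _ _) _; rewrite cards1 cards2.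
    by case: (_ == _).
  apply: leq_trans (leq_card_setU _ _) _; apply: leq_trans budget.
  by rewrite leq_add // leq_imset_card.
have MP x : reflect [\/ [\/ x = a, x = b | x = c],
    (exists2 p, p \in crossing a b & p.1 = x /\ x <> c) |
    (exists2 p, p \in crossing a c & between c b x /\ p.2 = x)] (x \in M).
  apply: (iffP idP) => [|xM].
    rewrite /M !in_setU !in_set1 => /orP[/orP[|]|].
    - by move=> /orP[/orP[]|] /eqP; constructor; [constructor 1|constructor 2|constructor 3].
    - case/imsetP=> p /setIdP[pX /eqP pc] ->; constructor 2; exists p => //.
    - by case/imsetP=> p /setIdP[pX pb] ->; constructor 3; exists p.
  rewrite /M !in_setU !in_set1; case: xM => [[]->|[p pX [<- /eqP pc]]|[p pX [pb px]]].
  - by rewrite eqxx.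
  - by rewrite eqxx orbT.
  - by rewrite eqxx !orbT.
  - by apply/orP; left; apply/orP; right; apply: imset_f; rewrite inE pX.
  - by apply/orP; right; apply/imsetP; exists p; rewrite // inE pX px.
have bc : rk b == rk c = false by lia.
have sub12 : (piece a c :|: snd @: Y1) :&: (piece c b :|: snd @: Y2) \subset M.
  apply/subsetP => x /setIP[/setUP xA1 /setUP xA2]; apply/MP.
  have [->|xa] := eqVneq x a; first by constructor; constructor 1.
  have [->|xb] := eqVneq x b; first by constructor; constructor 2.
  have [->|xc] := eqVneq x c; first by constructor; constructor 3.
  rewrite !rkE in xa xb xc.
  have {}xA2 : within c b x.
    case: xA2 => [|/imsetP[p /setIdP[_ /eqP pa] xp]]; first by rewrite inE.
    by rewrite xp pa eqxx in xa.
  case: xA1; first by rewrite inE; move: xA2; rewrite /within; lia.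
  case/imsetP=> p /setIdP[pX _] xp; constructor 3; exists p => //; split=> //.
  by move: xA2; rewrite /within /between; lia.
have sub1 : (piece a c :|: snd @: Y1) :&: M \subset mixed_bag a c Y1.
  apply/subsetP => x /setIP[/setUP[xA|xY] /MP xM]; last by rewrite in_setU xY orbT.
  move: xA; rewrite inE => xac; rewrite /mixed_bag !in_setU !in_set1.
  have [->|xa] := eqVneq x a; first by [].
  have [->|xc] := eqVneq x c; first by [].
  case: xM => [[xE|xE|xE]|[p pX [px _]]|[p _ [xcb _]]].
  - by rewrite xE eqxx in xa.
  - by rewrite xE /within in xac; lia.
  - by rewrite xE eqxx in xc.
  - apply/orP; left; apply/orP; right; apply/imsetP; exists p => //.
    move: xa xc; rewrite inE !inE !rkE; case/crossingP: pX => -> /= + pab xa xc.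
    move: xac; rewrite px negb_and.
    by rewrite /within /between in pab *; lia.
  - by move: xac xcb; rewrite /within /between; lia.
have sub2 : (piece c b :|: snd @: Y2) :&: M \subset mixed_bag c b Y2.
  apply/subsetP => x /setIP[/setUP[xA|xY] /MP xM]; last by rewrite in_setU xY orbT.
  move: xA; rewrite inE => xcb; rewrite /mixed_bag !in_setU !in_set1.
  have [->|xb] := eqVneq x b; first by rewrite orbT.
  have [->|xc] := eqVneq x c; first by [].
  case: xM => [[xE|xE|xE]|[p pX [px _]]|[p pX [_ px]]].
  - by rewrite xE /within in xcb; lia.
  - by rewrite xE eqxx in xb.
  - by rewrite xE eqxx in xc.
  - apply/orP; left; apply/orP; right; apply/imsetP; exists p => //.
    move: xb xc; rewrite inE !inE !rkE; case/crossingP: pX => -> /= + pab xb xc.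
    move: xcb; rewrite px negb_and.
    by rewrite /within /between in pab *; lia.
  - apply/orP; left; apply/orP; right; apply/imsetP; exists (p.2, p.1) => //.
    move: xb xc; rewrite inE !inE !rkE /= px adj_sym -px.
    case/crossingP: pX => -> /= pb pnw; rewrite px => xb xc.
    by move: xcb pb pnw; rewrite /within /between; lia.
have D := join_dec D1 D2 cM sub12 sub1 sub2.
(* A last root shrinks [M] to the bag required for [ab], forgetting in particular [c] unless it is
   an inner end of a crossing edge. *)
have sM : mixed_bag a b set0 \subset M.
  apply/subsetP => x; rewrite /mixed_bag setD0 imset0 setU0 => xab; apply/MP.
  move: xab; rewrite !inE => /orP[/orP[/eqP|/eqP]|/imsetP[p pX xp]].
  - by move->; constructor; constructor 1.
  - by move->; constructor; constructor 2.
  - have [->|xc] := eqVneq x c; first by constructor; constructor 3.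
    by constructor 2; exists p => //; split=> //; apply/eqP.
have cR : #|mixed_bag a b set0| <= 5 by apply: leq_trans (subset_leq_card sM) cM.
have D' := grow_dec D cR (subset_trans (subsetIr _ _) sM).
split; apply: weaken_dec D' _ _.
  rewrite imset0 setU0; apply/setP => x; apply/idP/idP; last first.
    rewrite inE => xab; rewrite !in_setU !in_set; suff : within a c x || within c b x.
      by case/orP=> ->; rewrite ?orbT.
    by move: xab; rewrite /within; lia.
  case/setUP=> [|/setUP[/setUP[|/setUP[|]]|/setUP[|]]].
  - by move/(subsetP (mixed_bag_sub _ ab)); rewrite imset0 setU0.
  - case/MP=> [[]->|[p /crossingP[_ + _] [<- _]]|[p _ [+ _]]];
      by rewrite inE /within /between; lia.
  - by rewrite !inE /within; lia.
  - by case/imsetP=> p /setIdP[_ + ->]; rewrite inE /within; lia.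
  - by rewrite !inE /within; lia.
  - by case/imsetP=> p /setIdP[_ /eqP-> ->]; rewrite inE /within; lia.
move=> u v [uv [[uab vab]||]]; try by rewrite inE.
right.
wlog lt_uv : u v uv uab vab / rk u < rk v.
  move=> hw; have [lt|le] := ltnP (rk u) (rk v); first exact: hw.
  have ne : u != v by apply: contraTneq uv => ->; rewrite adj_irr.
  have lt : rk v < rk u by move: ne; rewrite rkE; lia.
  have vu : adj v u by rewrite adj_sym.
  case: (hw v u vu vab uab lt) => [[]|[|]]; [by left| |].
    by move/mixed_edgeC; right; left.
  by move/mixed_edgeC; right; right.
(* An edge within one half is covered there. Otherwise [c] lies strictly between its ends: the edge
   is [ab], covered by [M], or starts at [a] and is in [Y2] reversed, or is in [Y1]. *)
have [vc|cv] := leqP (rk v) (rk c).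
  right; left; split=> //; constructor; move: uab vab; rewrite /within; lia.
have [cu|uc] := leqP (rk c) (rk u).
  right; right; split=> //; constructor; move: uab vab; rewrite /within; lia.
have [ua|ua] := eqVneq u a.
  have [vb|vb] := eqVneq v b.
    by left; rewrite ua vb; split; apply/MP; constructor; [constructor 1|constructor 2].
  right; right; split=> //; constructor 3; rewrite rkE in vb.
  rewrite !inE /= adj_sym uv ua eqxx /=.
  by move: vab; rewrite /within /between; lia.
right; left; split=> //; constructor 2; rewrite rkE in ua.
by rewrite !inE /= uv /=; move: uab vab; rewrite /within /between; lia.
Qed.

(** Ends at [a] or [b] are allowed, but not the chord [ab] itself, which may thus serve as the edge
    [g] in [thin]. *)
Definition inner (a b : G) (g : G * G) :=
  [&& within a b g.1, within a b g.2 & between a b g.1 || between a b g.2].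

(* If two edges cross a thin chord [ab], one of them meets an edge that does
   not lie strictly inside the piece of [ab], hence meets at most one inside. *)
Definition thin (a b : G) : Prop :=
  #|crossing a b| <= 2 /\
  (#|crossing a b| = 2 -> exists2 p, p \in crossing a b &
     exists2 g, g \in crossing p.1 p.2 & ~~ inner a b g).

(** * Choice of the cut vertex of a thin chord *)

Hypothesis edge_crossing : forall u v : G, adj u v -> #|crossing u v| <= 2.

Let swap (p : G * G) := (p.2, p.1).
Let swap_inj : injective swap.
Proof. by move=> [? ?] [? ?] [-> ->]. Qed.

Lemma crossing_sym u v p : adj u v -> p \in crossing u v ->
  (u, v) \in crossing p.1 p.2 \/ (v, u) \in crossing p.1 p.2.
Proof.
move=> uv /crossingP[_ pb pw].
have [ub|ub] := boolP (between p.1 p.2 u); [left|right]; apply/crossingP.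
  by split=> //; move: pb pw ub; rewrite /between /within /=; lia.
by split; rewrite /= 1?adj_sym //; move: pb pw ub; rewrite /between /within; lia.
Qed.

(** Let [c] be the last neighbour of [a] strictly inside, or the vertex next to [a] if there is
    none. Then [ac] is an edge or has nothing to cross it. Since [ab] is uncrossed and [a] has no
    inner neighbour after [c], every edge crossing [cb] also crosses [ac]. If there are crossings,
    the edge [ac] witnesses thinness on both sides. *)
Lemma thin_split_uncrossed a b : rk a < rk b -> crossing a b = set0 ->
  (exists x, between a b x) ->
  exists c, [/\ rk a < rk c < rk b, thin a c, thin c b &
    #|[set p in crossing a b | p.1 != c]|
      + #|[set p in crossing a c | between c b p.2]| <= 2].
Proof.
move=> ab ab0 [x0 x0ab].
pose Q x := between a b x && (adj a x || [forall y, ~~ between a x y]).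
have [x1 Qx1] : exists x, Q x.
  have [x xab xmin] := @arg_minnP _ x0 (between a b) rk x0ab.
  exists x; rewrite /Q xab; apply/orP; right; apply/forallP => y; apply/negP => yb.
  have /xmin : between a b y by move: xab yb; rewrite /between; lia.
  by move: xab yb; rewrite /between; lia.
have [c /andP[cab ac] cmax] := @arg_maxnP _ x1 Q rk Qx1.
have {}cab : rk a < rk c < rk b by move: cab; rewrite /between; lia.
have far x : between a b x -> adj a x -> rk x <= rk c.
  by move=> xab ax; apply: cmax; rewrite /Q xab ax.
have adj_ac p : p \in crossing a c -> adj a c.
  case/orP: ac => // /forallP noy /crossingP[_ pb _].
  by have := noy p.1; rewrite pb.
have cac : #|crossing a c| <= 2.
  have [->|[p /adj_ac/edge_crossing//]] := set_0Vmem (crossing a c).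
  by rewrite cards0.
have scb p : p \in crossing c b -> swap p \in crossing a c.
  case/crossingP=> pp pb pw; have [pab|pab] := boolP (within a b p.2); last first.
    have : p \in crossing a b.
      by apply/crossingP; split=> //; move: pb cab; rewrite /between /within; lia.
    by rewrite ab0 inE.
  have pa : p.2 != a.
    apply/eqP => pa; have : rk p.1 <= rk c.
      apply: far; last by rewrite -pa adj_sym.
      by move: pb; rewrite /between; lia.
    by move: pb; rewrite /between; lia.
  rewrite rkE in pa; apply/crossingP; split=> /=; first by rewrite adj_sym.
    by move: pb pw pab pa; rewrite /between /within; lia.
  by move: pb pw pab pa; rewrite /between /within; lia.
have ccb : #|crossing c b| <= #|crossing a c|.
  rewrite -(card_imset _ swap_inj); apply: subset_leq_card.
  by apply/subsetP => _ /imsetP[p /scb ? ->].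
exists c; split=> //.
- split=> // two.
  have [p pX] : exists p, p \in crossing a c by apply/card_gt0P; rewrite two.
  exists p => //; have [cr|cr] := crossing_sym (adj_ac p pX) pX.
    by exists (a, c) => //; rewrite /inner /between /=; lia.
  by exists (c, a) => //; rewrite /inner /between /=; lia.
- split; first exact: leq_trans ccb cac.
  move=> two.
  have [p pX] : exists p, p \in crossing c b by apply/card_gt0P; rewrite two.
  have sX := scb p pX; exists p => //.
  have crC : crossing p.1 p.2 = crossing p.2 p.1.
    by apply/setP => y; rewrite !inE /between /within orbC [X in ~~ X]orbC.
  rewrite crC; have [cr|cr] := crossing_sym (adj_ac _ sX) sX.
    by exists (a, c) => //; rewrite /inner /within /=; lia.
  by exists (c, a) => //; rewrite /inner /within /=; lia.
- have -> : [set p in crossing a b | p.1 != c] = set0.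
    by apply/setP => p; rewrite ab0 !inE.
  rewrite cards0; apply: leq_trans cac; apply: subset_leq_card.
  by apply/subsetP => p /setIdP[].
Qed.

(** An edge crossing [ac] or [cb] either passes over [c] inside the piece, and then crosses [cq], or
    is a crossing of [ab] other than [cq]. A single bound on these two kinds together gives all the
    required estimates. *)
Lemma thin_split_crossed a b : rk a < rk b -> thin a b -> crossing a b != set0 ->
  exists c, [/\ rk a < rk c < rk b, thin a c, thin c b &
    #|[set p in crossing a b | p.1 != c]|
      + #|[set p in crossing a c | between c b p.2]| <= 2].
Proof.
move=> ab [cab two] /set0Pn[e0 e0X].
have [[c q] eX eg] : exists2 e, e \in crossing a b & #|crossing a b| = 2 ->
    exists2 g, g \in crossing e.1 e.2 & ~~ inner a b g.
  have [/two[e eX eg]|ne] := eqVneq #|crossing a b| 2; first by exists e.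
  by exists e0 => // E; rewrite E in ne.
set X := crossing a b in cab two eX eg e0X *.
have /crossingP/=[cq cb qw] := eX.
have {cb} acb : rk a < rk c < rk b by move: cb; rewrite /between; lia.
(* The edges of the piece passing over [c], except [ab]; all are [inner] and cross [cq]. *)
pose W := [set p : G * G | [&& adj p.1 p.2, rk a <= rk p.1 < rk c,
  rk c < rk p.2 <= rk b & (rk a < rk p.1) || (rk p.2 < rk b)]].
(* In [crossing c q] the end between [c] and [q] comes first: the upper end if [q] lies past [b],
   the lower end if [q] precedes [a]. *)
pose f p := if rk b < rk q then swap p else p.
have f_inj : injective f by move=> p p'; rewrite /f; case: (rk b < rk q) => // /swap_inj.
have fW p : p \in W -> f p \in crossing c q /\ inner a b (f p).
  rewrite inE => /and4P[pp pa pb pab]; split.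
    apply/crossingP; rewrite /f; case: ifP => bq /=.
      by split; [rewrite adj_sym | move: bq qw; rewrite /between; lia
        | move: bq qw; rewrite /within; lia].
    by split=> //; move: bq qw; rewrite /between /within; lia.
  by rewrite /f /inner /within /between; case: ifP => bq /=; lia.
(* If [ab] is crossed once, the bound on the crossings of [cq] suffices. If twice, one crossing [g]
   of [cq] is not [inner], which leaves at most one for [W]. *)
have cW : #|W| + #|X :\ e0| <= 2.
  have := cardsD1 e0 X; rewrite e0X add1n => cX; rewrite -(card_imset _ f_inj).
  have cr2 := edge_crossing cq.
  have [X2|X1] := eqVneq #|X| 2; last first.
    have -> : #|X :\ e0| = 0 by lia.
    rewrite addn0; apply: leq_trans cr2; apply: subset_leq_card.
    by apply/subsetP => _ /imsetP[p /fW[? _] ->].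
  have [g gX gin] := eg X2; have := cardsD1 g (crossing c q).
  rewrite gX add1n => cg.
  suff : #|f @: W| <= #|crossing c q :\ g| by lia.
  apply: subset_leq_card; apply/subsetP => _ /imsetP[p /fW[pX pin] ->].
  by rewrite in_setD1 pX andbT; apply: contraNneq gin => <-.
have cXe e : e \in X -> #|X :\ e| = #|X|.-1.
  by move=> eX'; rewrite (cardsD1 e X) eX'.
have cWe : #|W| + #|X :\ (c, q)| <= 2.
  by rewrite (cXe _ eX) -(cXe _ e0X).
have crW p : p \in W -> (c, q) \in crossing p.1 p.2.
  rewrite inE => /and4P[pp pa pb pab]; apply/crossingP; split=> //=.
    by rewrite /between; lia.
  by move: qw; rewrite /within; lia.
have sac : crossing a c \subset W :|: (X :\ (c, q)).
  apply/subsetP => p /crossingP[pp pb pw]; apply/setUP.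
  have [pab|pab] := boolP (within a b p.2); [left|right].
    by rewrite inE pp; move: pb pw pab; rewrite /between /within; lia.
  rewrite in_setD1; apply/andP; split.
    by apply: contraTneq pb => ->; rewrite /between /=; lia.
  by apply/crossingP; split=> //; move: pb; rewrite /between; lia.
have scb : crossing c b \subset swap @: W :|: (X :\ (c, q)).
  apply/subsetP => p /crossingP[pp pb pw]; apply/setUP.
  have [pab|pab] := boolP (within a b p.2); [left|right].
    apply/imsetP; exists (swap p); last by case: (p).
    by rewrite inE /= adj_sym pp; move: pb pw pab; rewrite /between /within; lia.
  rewrite in_setD1; apply/andP; split.
    by apply: contraTneq pb => ->; rewrite /between /=; lia.
  by apply/crossingP; split=> //; move: pb; rewrite /between; lia.
have cX1 : #|X :\ (c, q)| <= 1 by rewrite cXe //; move: cab; case: #|X| => [|[|[]]].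
(* At most one crossing of [ab] differs from [cq], so a half crossed twice is crossed by an edge
   passing over [c]. That edge meets [cq], which is not inside the half: this is the witness of
   thinness. *)
have pick (S U : {set G * G}) : S \subset U :|: (X :\ (c, q)) -> #|S| = 2 ->
    exists2 p, p \in S & p \in U.
  move=> sub S2; have /subsetPn[p pS pX] : ~~ (S \subset X :\ (c, q)).
    by apply/negP => /subset_leq_card; rewrite S2; lia.
  exists p => //; have := subsetP sub p pS.
  by rewrite in_setU (negPf pX) orbF.
exists c; split=> //.
- split.
    apply: leq_trans (subset_leq_card sac) _.
    exact: leq_trans (leq_card_setU _ _) cWe.
  move=> /(pick _ _ sac)[p pX /crW cr]; exists p => //; exists (c, q) => //.
  by move: qw; rewrite /inner /within /=; lia.
- split.
    apply: leq_trans (subset_leq_card scb) _.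
    apply: leq_trans (leq_card_setU _ _) _.
    by rewrite (card_imset _ swap_inj).
  move=> /(pick _ _ scb)[p pX /imsetP[p' /crW cr pE]]; exists p => //.
  exists (c, q); last by move: qw; rewrite /inner /within /=; lia.
  rewrite pE /=; case/crossingP: cr => /= ? b1 w1; apply/crossingP; split=> //=.
    by move: b1; rewrite /between; lia.
  by move: w1; rewrite /within; lia.
- rewrite addnC; apply: leq_trans cWe; apply: leq_add; apply: subset_leq_card.
    apply/subsetP => p /setIdP[/crossingP[pp pb pw] pcb].
    by rewrite inE pp; move: pb pw pcb; rewrite /between /within; lia.
  apply/subsetP => p /setIdP[pX pc]; rewrite in_setD1 pX andbT.
  by apply: contra_neq pc => ->.
Qed.

Lemma thin_decomposable a b : rk a < rk b -> thin a b -> decomposable a b set0.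
Proof.
have [n] := ubnP (rk b - rk a); elim: n a b => // n IH a b; rewrite ltnS => le_n ab thin_ab.
have [/existsP nonempty|/existsPn empty] := boolP [exists x, between a b x].
  have [c [acb ac cb budget]] : exists c, [/\ rk a < rk c < rk b, thin a c, thin c b &
      #|[set p in crossing a b | p.1 != c]|
        + #|[set p in crossing a c | between c b p.2]| <= 2].
    have [ab0|abN0] := eqVneq (crossing a b) set0.
      exact: thin_split_uncrossed.
    exact: thin_split_crossed.
  have [ltac ltcb] := andP acb.
  apply: (split_decomposable acb (proj1 ac) (proj1 cb) budget).
    by apply: IH => //; lia.
  by apply: IH => //; lia.
have X0 : crossing a b = set0.
  by apply/setP => p; rewrite !inE (negPf (empty _)) andbF.
have eab : [set a; b] = piece a b.
  apply/setP => x; rewrite !inE !rkE; move: (empty x).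
  by rewrite /between /within; lia.
have cab : #|[set a; b]| <= 5 by rewrite cards2; case: (_ == _).
split; rewrite /mixed_bag X0 set0D !imset0 !setU0.
apply: (weaken_dec (leaf_dec cab) eab) => u v [_ [[uab vab]||]]; rewrite ?in_set0 //.
by rewrite eab !inE.
Qed.

(** The chord between the vertices of least and greatest rank, an edge or not, has all vertices in
    its piece, so it is uncrossed and thin. *)
Lemma ranked_treewidth : treewidth G <= 4.
Proof.
have [small|] := leqP #|G| 5.
  apply: (@rooted_treewidth G 4 setT); rewrite -cardsT in small.
  by apply: weaken_dec (leaf_dec small) _ _ => // u v _; rewrite !inE.
move=> big; have /card_gt1P[x [y [_ _ xy]]] : 1 < #|G| by apply: leq_trans big.
have [a _ amin] := @arg_minnP _ x predT rk isT.
have [b _ bmax] := @arg_maxnP _ x predT rk isT.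
have ab : rk a < rk b.
  rewrite rkE in xy; move: (amin x isT) (amin y isT) (bmax x isT) (bmax y isT).
  by move: xy => /eqP; lia.
have in_ab v : within a b v by rewrite /within amin //; apply/orP; left; apply: bmax.
have X0 : crossing a b = set0 by apply/setP => p; rewrite !inE in_ab !andbF.
have [D] : decomposable a b set0.
  by apply: thin_decomposable => //; rewrite /thin X0 cards0.
apply: (@rooted_treewidth G 4 (mixed_bag a b set0)).
apply: weaken_dec D _ _.
  by apply/setP => v; rewrite imset0 setU0 !inE in_ab.
by move=> u v uv; split=> //; constructor.
Qed.

End RankedGraph.

(** * Geometry of the circle *)

Import Order.TTheory GRing.Theory Num.Theory.

Section Orientation.
Variable R : realType.
Local Open Scope ring_scope.

(** Twice the signed area of the triangle, positive when it is counterclockwise. *)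
Definition orient (a b c : 'rV[R]_2) : R :=
  (b 0 0 - a 0 0) * (c 0 1 - a 0 1) - (b 0 1 - a 0 1) * (c 0 0 - a 0 0).

Lemma row2P (p q : 'rV[R]_2) : p 0 0 = q 0 0 -> p 0 1 = q 0 1 -> p = q.
Proof.
move=> e0 e1; apply/rowP; case=> [[|[|//]] lt].
  by rewrite (_ : Ordinal lt = 0) //; apply: val_inj.
by rewrite (_ : Ordinal lt = 1) //; apply: val_inj.
Qed.

Lemma orient_convex (a b p q : 'rV[R]_2) (t : R) :
  orient a b ((1 - t) *: p + t *: q) = (1 - t) * orient a b p + t * orient a b q.
Proof. by rewrite /orient !mxE; ring. Qed.

(* The four orientations are, up to signs, the coefficients of the affine
   dependency between the four points. *)
Lemma chords_meet (a b c d : 'rV[R]_2) :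
  0 < orient a b c -> 0 < orient a c d -> 0 < orient a b d -> 0 < orient b c d ->
  exists p, open_segment a c p /\ open_segment b d p.
Proof.
move=> abc acd abd bcd; set S := orient b c d + orient a b d.
have SE : S = orient a c d + orient a b c by rewrite /S /orient; ring.
have S0 : S != 0 by rewrite gt_eqF // addr_gt0.
have frac (u : R) : 0 < u -> 0 < S - u -> 0 < u / S < 1.
  move=> u0 Su; have S_gt0 : 0 < S by rewrite addr_gt0.
  by rewrite divr_gt0 // ltr_pdivrMr // mul1r -subr_gt0.
exists ((1 - orient a b d / S) *: a + (orient a b d / S) *: c); split.
  by exists (orient a b d / S) => //; apply: frac => //; rewrite addrK.
exists (orient a b c / S); first by apply: frac => //; rewrite SE addrK.
have comb (u x y : R) : (1 - u / S) * x + u / S * y = ((S - u) * x + u * y) / S.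
  by field.
by apply: row2P; rewrite !mxE !comb; congr (_ / _); rewrite /S /orient; ring.
Qed.

(** The rational parametrization of the circle by stereographic projection; it misses only the
    leftmost point. *)
Definition circle_point (c : 'rV[R]_2) (r k : R) : 'rV[R]_2 :=
  \row_j (if j == 0 then c 0 0 + r * (1 - k ^+ 2) / (1 + k ^+ 2)
          else c 0 1 + r * (2 * k) / (1 + k ^+ 2)).

Let sqr1_neq0 (k : R) : 1 + k ^+ 2 != 0.
Proof. by rewrite gt_eqF // ltr_pwDl // sqr_ge0. Qed.

Lemma circle_point_on c (r k : R) : on_circle c r (circle_point c r k).
Proof. by rewrite /on_circle !mxE /=; field. Qed.

Lemma orient_circle_point c (r i j k : R) :
  orient (circle_point c r i) (circle_point c r j) (circle_point c r k) =
  4 * r ^+ 2 * ((j - i) * (k - i) * (k - j)) /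
    ((1 + i ^+ 2) * (1 + j ^+ 2) * (1 + k ^+ 2)).
Proof. by rewrite /orient !mxE /=; field; rewrite !sqr1_neq0. Qed.

Lemma orient_circle_point_gt0 c (r i j k : R) : 0 < r -> i < j -> j < k ->
  0 < orient (circle_point c r i) (circle_point c r j) (circle_point c r k).
Proof.
move=> r0 ij jk; have pos (x : R) : 0 < 1 + x ^+ 2.
  by rewrite ltr_pwDl // sqr_ge0.
rewrite orient_circle_point divr_gt0 ?mulr_gt0 ?exprn_gt0 ?subr_gt0 //.
exact: lt_trans jk.
Qed.

Lemma circle_point_inj c (r : R) : 0 < r -> injective (circle_point c r).
Proof.
move=> r0 i j eij; apply/eqP; case: (ltgtP i j) => // lt; exfalso.
  (* With a third, larger parameter the triangle would have positive area, yet two of its corners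
     coincide. *)
  have := orient_circle_point_gt0 c r0 lt (ltr_pwDr ltr01 (lexx j)).
  by rewrite eij /orient !subrr !mul0r subrr ltxx.
have := orient_circle_point_gt0 c r0 lt (ltr_pwDr ltr01 (lexx i)).
by rewrite eij /orient !subrr !mul0r subrr ltxx.
Qed.

End Orientation.

(** * The circular order of a convex drawing *)

Section CircularOrder.
Variables (R : realType) (G : sgraph) (D : convex_drawing R G).
Local Open Scope ring_scope.
Notation c := (center D).
Notation r := (radius D).

Let X (v : G) := D v 0 0 - c 0 0 + r.
Let Y (v : G) := D v 0 1 - c 0 1.

Let circleE v : X v ^+ 2 + Y v ^+ 2 = 2 * r * X v.
Proof.
have := position_on_circle D v; rewrite /on_circle -/(Y v).
have -> : D v 0 0 - c 0 0 = X v - r by rewrite /X; ring.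
by move=> e; nra.
Qed.

(* Stereographic projection from the point of the circle with X = 0; a vertex
   placed there is the maximum of the order below. *)
Let slope v := Y v / X v.

Definition before (u v : G) := (X u != 0) && ((X v == 0) || (slope u < slope v)).

Let pos_slope v : X v != 0 -> D v = circle_point c r (slope v).
Proof.
move=> Xv; have r0 := radius_gt0 D.
have rX0 : 2 * r * X v != 0 by rewrite !mulf_neq0 // ?pnatr_eq0 // gt_eqF.
have kE : 1 + slope v ^+ 2 = 2 * r / X v.
  have -> : 2 * r / X v = 2 * r * X v / X v ^+ 2 by field.
  by rewrite -circleE /slope; field.
have rn : r != 0 by rewrite gt_eqF.
apply: row2P; rewrite !mxE /= kE.
  have -> : 1 - slope v ^+ 2 = 2 - 2 * r / X v.
    by rewrite -kE; ring.
  have -> : r * (2 - 2 * r / X v) / (2 * r / X v) = X v - r.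
    by field; rewrite Xv.
  by rewrite /X; ring.
have -> : r * (2 * slope v) / (2 * r / X v) = Y v.
  by rewrite /slope; field; rewrite Xv rn.
by rewrite /Y; ring.
Qed.

Let pos0 v : X v = 0 -> D v 0 0 = c 0 0 - r /\ D v 0 1 = c 0 1.
Proof.
move=> Xv; have := circleE v; rewrite Xv mulr0 expr0n add0r => /eqP.
rewrite sqrf_eq0 => /eqP Yv; split.
  by apply/eqP; rewrite -subr_eq0 -[X in _ == X]Xv /X; apply/eqP; ring.
by apply/eqP; rewrite -subr_eq0 -/(Y v) Yv.
Qed.

Lemma before_irr v : ~~ before v v.
Proof. by rewrite /before ltxx orbF andNb. Qed.

Lemma before_trans : transitive before.
Proof.
move=> v u w; rewrite /before => /andP[-> /orP[/eqP->|uv]] /andP[Xv];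
  first by rewrite eqxx in Xv.
by case/orP=> [->//|vw]; rewrite (lt_trans uv vw) orbT.
Qed.

Lemma before_total u v : u != v -> before u v || before v u.
Proof.
rewrite /before; have [Xu|Xu] := eqVneq (X u) 0; have [Xv|Xv] //= := eqVneq (X v) 0.
  move=> /eqP[]; apply: (@position_inj _ _ D); have [] := pos0 Xu; have [] := pos0 Xv.
  by move=> e1 e2 e3 e4; apply: row2P; rewrite ?e1 ?e2 ?e3 ?e4.
move=> uv; rewrite -neq_lt; apply: contra_neq uv => e.
by apply: (@position_inj _ _ D); rewrite !pos_slope // e.
Qed.

Definition circular_rank (v : G) : nat := #|[set u | before u v]|.
Notation rk := circular_rank.

Lemma before_rank u v : before u v -> (rk u < rk v)%N.
Proof.
move=> uv; apply: proper_card; apply/properP; split.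
  by apply/subsetP => w; rewrite !inE => wu; apply: before_trans uv.
by exists u; rewrite !inE ?before_irr.
Qed.

Lemma circular_rank_inj : injective rk.
Proof.
move=> u v e; apply/eqP; apply: contraT => /before_total.
by case/orP=> /before_rank; rewrite e ltnn.
Qed.

Lemma rank_before u v : (rk u < rk v)%N -> before u v.
Proof.
move=> uv; have : u != v by apply: contraTneq uv => ->; rewrite ltnn.
by move/before_total => /orP[//|/before_rank /(ltn_trans uv)]; rewrite ltnn.
Qed.

Lemma orient_gt0 u v w : (rk u < rk v)%N -> (rk v < rk w)%N ->
  0 < orient (D u) (D v) (D w).
Proof.
move=> /rank_before uv /rank_before vw; have r0 := radius_gt0 D.
move: uv vw; rewrite /before => /andP[Xu uv] /andP[Xv vw].
rewrite (negPf Xv) /= in uv; rewrite (pos_slope Xu) (pos_slope Xv).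
(* Only [w] can be the projection centre, the maximum of the order; having no parameter, it is
   treated by direct computation. *)
have [Xw|Xw] := eqVneq (X w) 0; last first.
  rewrite (negPf Xw) /= in vw.
  by rewrite (pos_slope Xw); apply: orient_circle_point_gt0.
have [e0 e1] := pos0 Xw; rewrite /orient !mxE /= e0 e1.
have pos (x : R) : 0 < 1 + x ^+ 2 by rewrite ltr_pwDl // sqr_ge0.
have nz (x : R) : 1 + x ^+ 2 != 0 by rewrite gt_eqF.
set a := slope u in uv *; set b := slope v in uv *.
rewrite (_ : _ - _ = 4 * r ^+ 2 * (b - a) / ((1 + a ^+ 2) * (1 + b ^+ 2))); last first.
  by field; rewrite !nz.
by rewrite divr_gt0 ?mulr_gt0 ?exprn_gt0 ?subr_gt0.
Qed.

Lemma rank_chords_meet u v w z :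
  (rk u < rk v)%N -> (rk v < rk w)%N -> (rk w < rk z)%N ->
  exists p, open_segment (D u) (D w) p /\ open_segment (D v) (D z) p.
Proof.
move=> uv vw wz; apply: chords_meet; apply: orient_gt0 => //.
- exact: ltn_trans vw.
- exact: ltn_trans wz.
Qed.

Lemma alternating_cross u v x y : between rk u v x -> ~~ within rk u v y ->
  edges_cross D [set u; v] [set x; y].
Proof.
wlog uv : u v / (rk u < rk v)%N.
  move=> hw ux uy; have [lt|le] := ltnP (rk u) (rk v); first exact: hw.
  rewrite setUC; apply: hw.
  - by move: ux le; rewrite /between; lia.
  - by move: ux; rewrite /between; lia.
  - by move: uy; rewrite /within; lia.
rewrite /between /within => ux uy.
have [vy|yv] := ltnP (rk v) (rk y).
  have [|||p [uvp xyp]] := @rank_chords_meet u x v y; try by lia.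
  by exists p; split; [exists u, v | exists x, y].
have [|||p [yxp uvp]] := @rank_chords_meet y u x v; try by lia.
by exists p; split; [exists u, v | exists y, x; rewrite setUC].
Qed.

(** Forgetting the orientation of the pairs in [crossing] is injective, since the first end is the
    one lying between [u] and [v]. *)
Lemma rank_crossing k u v : outer_kplanar_drawing k D -> adj u v ->
  (#|crossing rk u v| <= k)%N.
Proof.
move=> planar uv; set e : {set G} := [set u; v].
have eE : e \in edges G by apply/imsetP; exists (u, v); rewrite ?inE.
apply: leq_trans (planar e eE); pose h (p : G * G) := [set p.1; p.2].
rewrite -(@card_in_imset _ _ h); last first.
  move=> p q /crossingP[_ pb pw] /crossingP[_ qb qw] /setP hpq.
  have p1 : p.1 = q.1.
    have := hpq p.1; rewrite !inE eqxx /= => /esym/orP[/eqP//|/eqP pq].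
    by move: pb qw; rewrite pq /between /within; lia.
  have p2 : p.2 = q.2.
    have := hpq p.2; rewrite !inE eqxx orbT => /esym/orP[/eqP pq|/eqP//].
    by move: pw qb; rewrite pq /between /within; lia.
  by case: p q p1 p2 {pb pw qb qw hpq} => [? ?] [? ?] /= -> ->.
apply: subset_leq_card; apply/subsetP => _ /imsetP[p /crossingP[pp pb pw] ->].
rewrite in_set in_setD1; apply/andP; split; last first.
  by apply/asboolP; apply: alternating_cross.
apply/andP; split; last by apply/imsetP; exists p; rewrite ?inE.
apply: contraTneq pb => /setP/(_ p.1); rewrite !inE eqxx /= => /esym/orP[]/eqP->;
  by rewrite /between; lia.
Qed.

End CircularOrder.

Lemma outer_2planar_treewidth (R : realType) (G : sgraph) :
  outer_kplanar R 2 G -> treewidth G <= 4.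
Proof.
case=> D planar; apply: (ranked_treewidth (@circular_rank_inj _ _ D)) => u v.
exact: rank_crossing.
Qed.

(** * Convex drawings of complete graphs *)

Lemma neq_op_sym (T : eqType) : symmetric (fun x y : T => x != y).
Proof. by move=> x y; rewrite eq_sym. Qed.

Lemma neq_op_irr (T : eqType) : irreflexive (fun x y : T => x != y).
Proof. by move=> x; rewrite eqxx. Qed.

Definition complete_graph (n : nat) : sgraph :=
  SGraph (@neq_op_sym 'I_n) (@neq_op_irr 'I_n).

Section CompleteDrawing.
Variables (R : realType) (n : nat).
Local Open Scope ring_scope.

Lemma complete_position_inj :
  injective (fun i : complete_graph n => circle_point 0 1 (i : nat)%:R : 'rV[R]_2).
Proof.
move=> i j /(circle_point_inj ltr01)/eqP; rewrite eqr_nat => /eqP e.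
exact: val_inj.
Qed.

Definition complete_drawing : convex_drawing R (complete_graph n) :=
  ConvexDrawing ltr01 complete_position_inj
    (fun i => circle_point_on 0 1 (i : nat)%:R).
Notation D := complete_drawing.

Lemma complete_orient_gt0 (i j k : complete_graph n) :
  (val i < val j)%N -> (val j < val k)%N -> 0 < orient (D i) (D j) (D k).
Proof. by move=> ij jk; apply: orient_circle_point_gt0; rewrite ?ltr_nat. Qed.

Lemma card_edge (G : sgraph) (e : {set G}) : e \in edges G -> #|e| = 2.
Proof.
case/imsetP=> -[u v]; rewrite inE /= => uv ->; rewrite cards2.
by case: eqP uv => // ->; rewrite adj_irr.
Qed.

(** The affine form [g] vanishes on the line [xy], is negative at the vertices strictly between and
    positive at the other ones. It vanishes at the common point, so the ends of [f] have opposite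
    signs unless both are on the line, which would force [f] to be the edge [xy]. *)
Lemma complete_crossing (x y : complete_graph n) (f : {set complete_graph n}) :
  (val x < val y)%N -> f \in edges _ -> f != [set x; y] ->
  edges_cross D [set x; y] f ->
  exists p, [/\ (val x < val p.1 < val y)%N,
    ((val p.2 < val x) || (val y < val p.2))%N & f = [set p.1; p.2]].
Proof.
move=> xy fE fxy [p [[x' [y' [exy [t _ pE]]]] [u [v [fuv [s /andP[s0 s1] ps]]]]]].
pose g q := orient (D x) (D y) q.
have gx : g (D x) = 0 by rewrite /g /orient !subrr !mulr0 subrr.
have gy : g (D y) = 0 by rewrite /g /orient; ring.
have gxy z : z \in [set x; y] -> g (D z) = 0 by rewrite !inE => /orP[]/eqP->.
have g0 : g p = 0.
  rewrite pE /g orient_convex -/(g _) -/(g _) !gxy ?exy ?inE ?eqxx ?orbT //.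
  by rewrite !mulr0 addr0.
have in_neg z : (val x < val z < val y)%N -> g (D z) < 0.
  case/andP=> xz zy; rewrite (_ : g _ = - orient (D x) (D z) (D y)).
    by rewrite oppr_lt0; apply: complete_orient_gt0.
  by rewrite /g /orient; ring.
have out_pos z : ((val z < val x) || (val y < val z))%N -> 0 < g (D z).
  case/orP=> lt; last exact: complete_orient_gt0.
  rewrite (_ : g _ = orient (D z) (D x) (D y)); first exact: complete_orient_gt0.
  by rewrite /g /orient; ring.
have tri z : [\/ (val x < val z < val y)%N, ((val z < val x) || (val y < val z))%N
    | z \in [set x; y]].
  have [->|zx] := eqVneq z x; first by constructor 3; rewrite !inE eqxx.
  have [->|zy] := eqVneq z y; first by constructor 3; rewrite !inE eqxx orbT.
  have {}zx : val z != val x by apply: contra_neq zx => /val_inj.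
  have {}zy : val z != val y by apply: contra_neq zy => /val_inj.
  have [] : (val x < val z < val y)%N \/ ((val z < val x) || (val y < val z))%N.
    by move: zx zy; lia.
  - by constructor 1.
  - by constructor 2.
have {ps g0} : (1 - s) * g (D u) + s * g (D v) = 0.
  by rewrite -orient_convex -ps.
have s1' : 0 < 1 - s by rewrite subr_gt0.
have fe : u \in [set x; y] -> v \in [set x; y] -> False.
  move=> ue ve; move/negP: fxy; apply; rewrite eqEcard (card_edge fE) cards2.
  rewrite (_ : x != y) ?andbT; last by apply: contraTneq xy => ->; rewrite ltnn.
  by rewrite fuv; apply/subsetP => z; rewrite inE => /orP[]/set1P->.
case: (tri u) => [ui|uo|ue]; case: (tri v) => [vi|vo|ve].
- have := in_neg _ ui; have := in_neg _ vi; nra.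
- by move=> _; exists (u, v).
- by rewrite (gxy v) //; have := in_neg _ ui; nra.
- by move=> _; exists (v, u); rewrite /= setUC.
- have := out_pos _ uo; have := out_pos _ vo; nra.
- by rewrite (gxy v) //; have := out_pos _ uo; nra.
- by rewrite (gxy u) //; have := in_neg _ vi; nra.
- by rewrite (gxy u) //; have := out_pos _ vo; nra.
- by case: fe.
Qed.

End CompleteDrawing.

(** A crossing edge joins the two sides of the chord. The three remaining vertices are shared
    between the sides, so there are at most 1 * 2 such edges. *)
Lemma complete5_outer_2planar (R : realType) : outer_kplanar R 2 (complete_graph 5).
Proof.
exists (complete_drawing R 5) => e /imsetP[[x y]]; rewrite inE /= => xy ->.
wlog lt_xy : x y xy / val x < val y.
  move=> hw; have [lt|le] := ltnP (val x) (val y); first exact: hw.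
  rewrite setUC; apply: hw; first by rewrite eq_sym.
  by rewrite ltn_neqAle le andbT eq_sym; apply: contra_neq xy => /val_inj.
have [i xi] : exists i : nat, val x = i by exists (val x).
have [j yj] : exists j : nat, val y = j by exists (val y).
rewrite xi yj in lt_xy.
pose I := [set z : 'I_5 | i < z < j].
pose O := [set z : 'I_5 | (z < i) || (j < z)].
have IO : #|I| + #|O| <= 3.
  have IO0 : I :&: O = set0 by apply/setP => z; rewrite !inE; lia.
  rewrite -cardsUI IO0 cards0 addn0.
  have -> : I :|: O = ~: [set x; y].
    apply/setP => z; rewrite !inE.
    have -> : (z == x) = (z == i :> nat) by rewrite -xi.
    have -> : (z == y) = (z == j :> nat) by rewrite -yj.
    by lia.
  by rewrite cardsCs setCK cards2 xy card_ord.
have : #|[set ([set p.1; p.2] : {set 'I_5}) | p in setX I O]| <= 2.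
  apply: leq_trans (leq_imset_card _ _) _; rewrite cardsX.
  by move: #|I| #|O| IO => [|[|[|[|a]]]] [|[|[|[|b]]]].
apply: leq_trans; apply: subset_leq_card; apply/subsetP => f.
rewrite inE in_setD1 => /andP[/andP[ne fE] /asboolP cr].
have [|p [pI pO ->]] := complete_crossing _ fE ne cr; first by rewrite xi yj.
rewrite xi yj in pI pO.
by apply/imsetP; exists p; rewrite // !inE; apply/andP.
Qed.

Theorem theorem12 (R : realType) :
  (forall G : sgraph, outer_kplanar R 2 G -> treewidth G <= 4) /\
  (exists G : sgraph, outer_kplanar R 2 G /\ treewidth G = 4).
Proof.
split; first exact: outer_2planar_treewidth.
exists (complete_graph 5); have planar := complete5_outer_2planar R.
split=> //; apply/eqP; rewrite eqn_leq (outer_2planar_treewidth planar) /=.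
(* Adjacency in [complete_graph] is [!=] by definition, so the identity proves completeness. *)
have := @complete_treewidth (complete_graph 5) (fun u v => id).
by rewrite card_ord.
Qed.
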